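(* Let $a<b$ be real numbers and let $f \in C^1[a,b]$ be real-valued. If there is some $\alpha_0 \in (0,1)$ such that $D^\alpha_{*a} f(t) \ge 0$ for all $t \in [a,b]$ and all $\alpha \in (\alpha_0,1)$, then $f$ is monotone increasing on $[a,b]$. Similarly, if there is some $\alpha_0 \in (0,1)$ such that $D^\alpha_{*a} f(t) \le 0$ for all $t \in [a,b]$ and all $\alpha \in (\alpha_0,1)$, then $f$ is monotone decreasing on $[a,b]$.
   Context: For $f \in C^1[a,b]$ and $\alpha \in (0,1)$, the Caputo derivative of order $\alpha$ of $f$ with starting point $a$ is $D^\alpha_{*a} f(t) := J^{1-\alpha}_a f'(t)$, where for $\beta>0$ the Riemann-Liouville integral operator with starting point $a$ is $J^\beta_a g(t) := \frac{1}{\Gamma(\beta)} \int_a^t (t-s)^{\beta-1} g(s)\,\mathrm{d}s$. Thus $D^\alpha_{*a} f(t) = \frac{1}{\Gamma(1-\alpha)} \int_a^t (t-s)^{-\alpha} f'(s)\,\mathrm{d}s$ for $t \in [a,b]$ (in particular, the value at $t=a$ is $0$). The terms ''increasing'' and ''decreasing'' are used in the non-strict sense. *)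

(* Defs.v *)
From mathcomp Require Import all_boot all_order all_algebra.
From mathcomp Require Import all_classical all_reals all_analysis.

Set Implicit Arguments.
Unset Strict Implicit.
Unset Printing Implicit Defensive.

Import Order.TTheory GRing.Theory Num.Theory.
Import numFieldNormedType.Exports.

Local Open Scope classical_set_scope.
Local Open Scope ring_scope.

(* Difference quotients of f at x along the points y != x of D: at an endpoint
   of D = `[a, b] the limit is the one-sided derivative, and values of f
   outside D never matter. *)
Definition diff_quotient_in (R : realType) (D : set R) (f : R -> R) (x : R) :=
  (f y - f x) / (y - x) @[y --> within D x^'].

Definition derivable_in (R : realType) (D : set R) (f : R -> R) (x : R) : Prop :=
  cvg (diff_quotient_in D f x).

Definition derive_in (R : realType) (D : set R) (f : R -> R) (x : R) : R :=
  lim (diff_quotient_in D f x).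

Definition C1_on (R : realType) (a b : R) (f : R -> R) : Prop :=
  (forall x, x \in `[a, b] -> derivable_in `[a, b] f x) /\
  {within `[a, b], continuous (derive_in `[a, b] f)}.

Definition Gamma (R : realType) (z : R) : R :=
  \int[lebesgue_measure]_(x in `]0, +oo[) (x `^ (z - 1) * expR (- x)).

(* For beta < 1 the kernel is singular at s = t, where powR returns the junk
   value 0 `^ (beta - 1) = 0; a single point is Lebesgue-negligible. *)
Definition RL_integral (R : realType) (beta a : R) (g : R -> R) (t : R) : R :=
  (Gamma beta)^-1 *
  \int[lebesgue_measure]_(s in `[a, t]) ((t - s) `^ (beta - 1) * g s).

(* b only serves to fix the interval on which f is differentiated. *)
Definition Caputo (R : realType) (alpha a b : R) (f : R -> R) (t : R) : R :=
  RL_integral (1 - alpha) a (derive_in `[a, b] f) t.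

(* Main.v *)
Require Import Defs.
From mathcomp Require Import all_boot all_order all_algebra.
From mathcomp Require Import all_classical all_reals all_analysis.
From mathcomp Require Import measurable_realfun ring lra.
Set Implicit Arguments.
Unset Strict Implicit.
Unset Printing Implicit Defensive.
Import Order.TTheory GRing.Theory Num.Theory.
Import numFieldNormedType.Exports.
Local Open Scope classical_set_scope.
Local Open Scope ring_scope.

(** As the order alpha tends to 1, the exponent beta = 1 - alpha of the
Riemann-Liouville integral tends to 0 from the right and the kernel
(t - s) `^ (beta - 1) / Gamma beta concentrates its mass at s = t.  Hence the
sign of the Caputo derivative at t, for orders close to 1, must agree with the
sign of f' t, and f' cannot be negative anywhere in ]a, b[ when the Caputo
derivatives of all orders close to 1 are nonnegative.

The comparison of signs is quantitative.  Suppose that g = f' is continuous on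
[a, t] with g t < 0.  Choose c in [a, t[ and m > 0 with g <= - m on ]c, t], and
an upper bound M > 0 of g on [a, t].  For beta < 1 the kernel
k s = (t - s) `^ (beta - 1) is nondecreasing on [a, t[, so k * g is bounded on
the whole of [a, t] by - m * k + (M + m) * k c, and
  \int k * g <= - m * (t - a) `^ beta / beta
               + (M + m) * (t - a) * (t - c) `^ (beta - 1).
Since (t - c) `^ beta <= (t - a) `^ beta, the right-hand side is negative as
soon as beta < m * (t - c) / ((M + m) * (t - a)); this is
[RL_integral_near0_lt0].

Two integrability facts make this meaningful: an integral that diverges has
the real value 0, and so has its inverse.  The kernel is integrable, with
integral (t - a) `^ beta / beta, and Gamma beta is finite and positive.  Both
come from a fundamental theorem of calculus on an open interval,
[ge0_continuous_FTC2_oo], which allows integrands that blow up at an endpoint.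

Once the sign of f' is known on ]a, b[, monotonicity is the mean value theorem;
the decreasing case is the same statement about - f'. *)

(** * Fundamental theorem of calculus on an open interval *)

(** The antiderivative F has limits at both endpoints even when f blows up
there, so the usual theorem on the segments [a + h, b - h] passes to the limit
h -> 0 by monotone convergence. *)
Lemma ge0_continuous_FTC2_oo (R : realType) (f F : R -> R) (a b : R) :
  a < b -> {in `]a, b[, forall x, 0 <= f x} ->
  {in `]a, b[, continuous f} ->
  (forall x : R, x \in `]a, b[ -> is_derive x 1 F (f x)) ->
  F x @[x --> a^'+] --> F a -> F x @[x --> b^'-] --> F b ->
  (\int[lebesgue_measure]_(x in `]a, b[) (f x)%:E = (F b - F a)%:E)%E.
Proof.
move=> ab f0 cf F'f Fa Fb.
have dF x : x \in `]a, b[ -> derivable F x 1 by move=> /F'f [].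
(* The denominator n + 3 keeps a + h n < b - h n from n = 0 on. *)
pose h n : R := (b - a) / n.+3%:R.
have ba0 : 0 < b - a by rewrite subr_gt0.
have h0 n : 0 < h n by rewrite divr_gt0.
have hlt n : 2 * h n < b - a.
  rewrite /h mulrCA gtr_pMr// ltr_pdivrMr// mul1r ltr_nat.
  by [].
have hdec : {homo h : m n / (m <= n)%N >-> n <= m}.
  move=> m n mn; rewrite /h ler_pM2l// lef_pV2 ?posrE//.
  by rewrite ler_nat.
have hcvg : h n @[n --> \oo] --> (0 : R).
  rewrite -(mulr0 (b - a)); apply: cvgM; first exact: cvg_cst.
  rewrite (_ : (fun n => _) = [sequence harmonic (n + 2)%N]_n); last first.
    by apply/funext => n; rewrite /= addn2.
  by rewrite cvg_shiftn; exact: cvg_harmonic.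
pose I n := `[a + h n, b - h n]%classic.
have IE n x : I n x -> x \in `]a, b[.
  rewrite /I/= in_itv/= => /andP[ax xb].
  rewrite in_itv/= (lt_le_trans _ ax) ?ltrDl//=.
  by rewrite (le_lt_trans xb)// ltrBlDr ltrDl.
have UI : \bigcup_n I n = `]a, b[%classic.
  apply/seteqP; split=> [x [n _ /IE]//|x /= /[!in_itv]/= /andP[ax xb]].
  have m0 : 0 < Num.min (x - a) (b - x) by rewrite lt_min !subr_gt0 ax.
  have /cvgrPdist_lt /(_ _ m0)[N _ /(_ N (leqnn N))] := hcvg.
  rewrite /= sub0r normrN gtr0_norm// lt_min => /andP[h1 h2].
  by exists N => //; rewrite /I/= in_itv/=; apply/andP; split; lra.
have intI n : (\int[lebesgue_measure]_(x in I n) (f x)%:E =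
    (F (b - h n) - F (a + h n))%:E)%E.
  have cF x : x \in `]a, b[ -> F y @[y --> x] --> F x.
    by move=> xab; apply/differentiable_continuous/derivable1_diffP/dF.
  have lt1 : a + h n < b - h n by have := hlt n; lra.
  apply: continuous_FTC2 => //.
  - apply: continuous_in_subspaceT => x /set_mem /IE; exact: cf.
  - split.
    + by move=> x xI; apply: dF; apply: (IE n); apply: subset_itv_oo_cc xI.
    + apply/cvg_at_right_filter/cF/(IE n).
      by rewrite /I/= in_itv/= lexx ltW.
    + apply/cvg_at_left_filter/cF/(IE n).
      by rewrite /I/= in_itv/= lexx ltW.
  - by move=> x xI; rewrite derive1E; apply/derive_val/F'f/(IE n)/subset_itv_oo_cc.
rewrite -UI.
have cv : (\int[lebesgue_measure]_(x in I n) (f x)%:E @[n --> \oo] -->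
    \int[lebesgue_measure]_(x in \bigcup_n I n) (f x)%:E)%E.
  apply: ge0_nondecreasing_set_cvg_integral.
  - move=> m n mn; apply/subsetPset => x.
    rewrite /I/= !in_itv/= => /andP[x1 x2]; have := hdec _ _ mn.
    by move=> hmn; apply/andP; split; lra.
  - by move=> n; exact: measurable_itv.
  - move=> n; apply/measurable_EFinP.
    apply: subspace_continuous_measurable_fun; first exact: measurable_itv.
    apply: continuous_in_subspaceT => x /set_mem /IE; exact: cf.
  - by move=> n x /IE xab; rewrite lee_fin f0.
apply: (cvg_unique _ cv) => //.
rewrite (_ : (fun n => _) = (fun n => (F (b - h n) - F (a + h n))%:E)); last first.
  by apply/funext => n; rewrite -intI.
apply: cvg_EFin; first exact: nearW.
apply: cvgB.
- move/cvg_at_leftP : Fb; apply; split.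
    by move=> n; rewrite ltrBlDr ltrDl.
  by rewrite -[X in _ --> X]subr0; apply: cvgB => //; exact: cvg_cst.
- move/cvg_at_rightP : Fa; apply; split.
    by move=> n; rewrite ltrDl.
  by rewrite -[X in _ --> X]addr0; apply: cvgD => //; exact: cvg_cst.
Unshelve. all: by end_near. Qed.

(** * The Riemann-Liouville kernel and the Gamma function *)

Lemma continuous_powR_gt0 (R : realType) (r x : R) : 0 < x ->
  {for x, continuous (fun y => y `^ r)}.
Proof.
move=> x0; have dx : derivable (fun y => y `^ r) x 1.
  by apply: derivable_powR; rewrite in_itv/= x0.
exact/differentiable_continuous/derivable1_diffP.
Qed.

Lemma continuous_powR_subr (R : realType) (r t s : R) : s < t ->
  {for s, continuous (fun y => (t - y) `^ r)}.
Proof.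
rewrite -subr_gt0 => s0.
apply: (@continuous_comp R R R (fun y => t - y) (fun y => y `^ r)).
  by apply: cvgB; [exact: cvg_cst|exact: cvg_id].
exact: continuous_powR_gt0.
Qed.

Lemma integral_powR_left (R : realType) (beta b : R) : 0 < beta -> 0 < b ->
  (\int[lebesgue_measure]_(x in `]0%R, b[) (x `^ (beta - 1))%:E =
   (b `^ beta / beta)%:E)%E.
Proof.
move=> beta0 b0.
have der (x : R) : 0 < x ->
    is_derive x 1 (fun x => x `^ beta / beta) (x `^ (beta - 1)).
  move=> x0; have := is_deriveZ (beta^-1) (is_derive1_powR beta x0).
  rewrite /GRing.scale/= mulKf ?gt_eqF//.
  by congr is_derive; apply/funext => y /=; rewrite mulrC.
transitivity ((b `^ beta / beta - 0 `^ beta / beta)%:E); last first.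
  by rewrite powR0 ?gt_eqF// mul0r subr0.
apply: (@ge0_continuous_FTC2_oo _ _ (fun x => x `^ beta / beta)) => //.
- by move=> x _; exact: powR_ge0.
- move=> x; rewrite in_itv/= => /andP[x0 _].
  exact: continuous_powR_gt0.
- by move=> x; rewrite in_itv/= => /andP[x0 _]; exact: der.
- rewrite powR0 ?gt_eqF//; apply: cvgMl; exact: powR_cvg0.
- apply/cvg_at_left_filter.
  by apply: cvgMl; exact: continuous_powR_gt0.
Qed.

Lemma integral_powR_right (R : realType) (beta a t : R) : 0 < beta -> a < t ->
  (\int[lebesgue_measure]_(s in `]a, t[) ((t - s) `^ (beta - 1))%:E =
   ((t - a) `^ beta / beta)%:E)%E.
Proof.
move=> beta0 at0.
have der (s : R) : s < t ->
    is_derive s 1 (fun s => - ((t - s) `^ beta / beta)) ((t - s) `^ (beta - 1)).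
  rewrite -subr_gt0 => s0.
  have dB : is_derive s 1 (fun s => t - s) (-1).
    by have := is_deriveB (is_derive_cst t s 1) (is_derive_id s 1); rewrite sub0r.
  have /= := is_deriveZ (- beta^-1) (@is_derive1_comp R
    (fun x => x `^ beta) (fun s => t - s) _ _ _ (is_derive1_powR beta s0) dB).
  rewrite /GRing.scale/= mulrN1 mulrNN mulKf ?gt_eqF//.
  by congr is_derive; apply/funext => y /=; rewrite scaleNr mulrC.
transitivity ((- ((t - t) `^ beta / beta) - - ((t - a) `^ beta / beta))%:E); last first.
  by rewrite subrr powR0 ?gt_eqF// mul0r oppr0 sub0r opprK.
apply: (@ge0_continuous_FTC2_oo _ _ (fun s => - ((t - s) `^ beta / beta))) => //.
- by move=> x _; exact: powR_ge0.
- move=> x; rewrite in_itv/= => /andP[_ xt]; exact: continuous_powR_subr.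
- by move=> x; rewrite in_itv/= => /andP[_ x0]; exact: der.
- apply: cvg_at_right_filter; apply: cvgN; apply: cvgMl.
  exact: continuous_powR_subr.
- apply: cvgN; rewrite subrr powR0 ?gt_eqF//; apply: cvgMl.
  apply/cvg_at_leftP => u [ut ct].
  move/cvg_at_rightP: (powR_cvg0 beta0); apply; split.
    by move=> n; rewrite subr_gt0.
  by rewrite -(subrr t); apply: cvgB => //; exact: cvg_cst.
Qed.

(** Domination of the Riemann-Liouville integrands rests on this: the
singularity of the kernel at s = t is of order beta - 1 > -1. *)
Lemma integrable_powR_right (R : realType) (beta a t : R) : 0 < beta -> a < t ->
  lebesgue_measure.-integrable `[a, t] (EFin \o (fun s => (t - s) `^ (beta - 1))).
Proof.
move=> beta0 at0.
have mk D : measurable_fun D (EFin \o (fun s => (t - s) `^ (beta - 1))).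
  apply/measurable_EFinP/measurable_funTS.
  apply: (measurableT_comp (measurable_powR _)).
  by apply: measurable_funB.
apply/integrableP; split; first exact: mk.
under eq_integral do rewrite /= ger0_norm ?powR_ge0//.
rewrite integral_itv_bndoo; last exact: mk.
by rewrite integral_powR_right// ltry.
Qed.

(** Positivity includes finiteness of the integral, since a divergent one has
the value 0.  The integrand is at most x `^ (beta - 1) on ]0, 1[ and, as
beta <= 1, at most expR (- x), the density of the exponential law, on
[1, +oo[.  It is at least expR (- 1) on ]0, 1[. *)
Lemma Gamma_itv01_gt0 (R : realType) (beta : R) : 0 < beta <= 1 -> 0 < Gamma beta.
Proof.
move=> /andP[beta0 beta1]; rewrite /Gamma.
set f := fun x : R => x `^ (beta - 1) * expR (- x).
have f0 x : 0 <= f x by rewrite mulr_ge0 ?powR_ge0 ?expR_ge0.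
have mf D : measurable_fun D (EFin \o f).
  apply/measurable_EFinP/measurable_funTS; apply: measurable_funM.
    exact: measurable_powR.
  by apply: (measurableT_comp (@measurable_expR R)); exact: oppr_measurable.
have mexp D : measurable_fun D (fun x : R => (expR (- x))%:E).
  apply/measurable_EFinP/measurable_funTS.
  by apply: (measurableT_comp (@measurable_expR R)); exact: oppr_measurable.
rewrite /Rintegral fine_gt0//; apply/andP; split.
- apply: (@lt_le_trans _ _ (\int[lebesgue_measure]_(x in `]0%R, 1%R[) (expR (-1))%:E)%E).
    rewrite integral_cst//= lebesgue_measure_itv/= lte01 oppr0 adde0 mule1.
    by rewrite lte_fin expR_gt0.
  apply: (@le_trans _ _ (\int[lebesgue_measure]_(x in `]0%R, 1%R[) (f x)%:E)%E).
    apply: ge0_le_integral; first exact: measurable_itv.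
    - by move=> x _; rewrite lee_fin expR_ge0.
    - exact: measurable_cst.
    - exact: mf.
    - move=> x /=; rewrite in_itv/= => /andP[x0 x1]; rewrite lee_fin /f.
      rewrite -[leLHS]mul1r ler_pM ?expR_ge0//; last by rewrite ler_expR lerN2 ltW.
      rewrite -[leLHS](powRr0 x); apply: ger_powR; first by rewrite x0 ltW.
      by rewrite subr_le0.
  apply: ge0_subset_integral; try exact: measurable_itv.
  + exact: mf.
  + by move=> x _; rewrite lee_fin.
  + exact: subset_itvl.
- rewrite (_ : `]0, +oo[%classic = `]0, 1[ `|` `[1, +oo[); last first.
    by rewrite -itv_bndbnd_setU// bnd_simp.
  rewrite ge0_integral_setU//=; first last.
  + apply/disj_setPS => x [/=]; rewrite !in_itv/= andbT => /andP[_ x1].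
    by rewrite leNgt x1.
  + by move=> x _; rewrite lee_fin.
  + exact: mf.
  apply: lte_add_pinfty.
  + apply: (@le_lt_trans _ _ (\int[lebesgue_measure]_(x in `]0%R, 1%R[) (x `^ (beta - 1))%:E)%E).
      apply: ge0_le_integral; first exact: measurable_itv.
      * by move=> x _; rewrite lee_fin.
      * exact: mf.
      * by apply/measurable_EFinP; apply: measurable_funTS; exact: measurable_powR.
      * move=> x /=; rewrite in_itv/= => /andP[x0 x1]; rewrite lee_fin /f.
        rewrite ler_piMr ?powR_ge0// -expR0 ler_expR oppr_le0 ltW//.
    by rewrite integral_powR_left// ltry.
  + apply: (@le_lt_trans _ _ (\int[lebesgue_measure]_x (exponential_pdf 1 x)%:E)%E); last first.
      by rewrite integral_exponential_pdf// ltry.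
    apply: (@le_trans _ _ (\int[lebesgue_measure]_(x in `[1%R, +oo[) (exponential_pdf 1 x)%:E)%E); last first.
      apply: ge0_subset_integral => //.
      * by apply/measurable_EFinP; exact: measurable_exponential_pdf.
      * by move=> x _; rewrite lee_fin exponential_pdf_ge0.
    apply: ge0_le_integral; first exact: measurable_itv.
      * by move=> x _; rewrite lee_fin.
      * exact: mf.
      * by apply/measurable_EFinP; apply: measurable_funTS; exact: measurable_exponential_pdf.
      * move=> x /=; rewrite in_itv/= andbT => x1; rewrite lee_fin /f.
        rewrite exponential_pdfE ?(le_trans ler01)// mul1r mulN1r.
        rewrite ler_piMl ?expR_ge0//.
        rewrite -[leRHS](powRr0 x); apply: ler_powR => //.
        by rewrite subr_le0.
Qed.

(** * Sign of the Riemann-Liouville integral for small order *)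

Lemma integrable_kernelM (R : realType) (beta a t : R) (g : R -> R) :
  0 < beta -> a < t -> {within `[a, t], continuous g} ->
  lebesgue_measure.-integrable `[a, t]
    (EFin \o (fun s => (t - s) `^ (beta - 1) * g s)).
Proof.
move=> beta0 at0 cg.
have cpt : compact `[a, t] by exact: segment_compact.
have := @integrableMl _ _ _ (@lebesgue_measure R) `[a, t]
  (measurable_itv _) (EFin \o (fun s => (t - s) `^ (beta - 1))) g.
apply; first exact: integrable_powR_right.
- by apply: subspace_continuous_measurable_fun => //; exact: measurable_itv.
- have /compact_bounded[M [Mr HM]] := continuous_compact cg cpt.
  by exists M; split => // x Mx y aty; apply: HM => //; exists y.
Qed.

Lemma RL_integralN (R : realType) (beta a t : R) (g : R -> R) :
  0 < beta -> a < t -> {within `[a, t], continuous g} ->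
  RL_integral beta a (fun s => - g s) t = - RL_integral beta a g t.
Proof.
move=> beta0 at0 cg; rewrite /RL_integral -mulrN; congr (_ * _).
rewrite -[RHS]mulN1r -RintegralZl//; last exact: integrable_kernelM.
by apply: eq_Rintegral => s _; rewrite mulN1r mulrN.
Qed.

(** The near-diagonal part of the integral, where g <= - m, grows like
1 / beta as beta goes to 0, whereas the contribution of [a, c] stays
bounded. *)
Lemma RL_integral_near0_lt0 (R : realType) (a t : R) (g : R -> R) :
  a < t -> {within `[a, t], continuous g} -> g t < 0 ->
  \forall beta \near 0^'+, RL_integral beta a g t < 0.
Proof.
move=> at0 cg gt0.
have tat : `[a, t]%classic t by rewrite /= in_itv/= lexx ltW.
have [M0 M00 HM] : exists2 M : R, 0 < M & forall s, `[a, t]%classic s -> g s <= M.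
  have [c _ Hc] := EVT_max (ltW at0) cg.
  exists (`|g c| + 1); first by rewrite ltr_wpDl.
  move=> s /Hc /le_trans; apply.
  by rewrite (le_trans (ler_norm _))// lerDl.
pose m : R := - g t / 2.
have m0 : 0 < m by rewrite divr_gt0// oppr_gt0.
have [c [ac ct Hc]] : exists c, [/\ a <= c, c < t &
    forall s, c < s <= t -> g s <= - m].
  have /cvgrPdist_lt /(_ _ m0) [d /= d0 Hd] := (subspace_continuousP _ _).1 cg _ tat.
  exists (Num.max a (t - d)); split.
  - by rewrite le_max lexx.
  - by rewrite gt_max at0 ltrBlDr ltrDl.
  - move=> s /andP[]; rewrite gt_max => /andP[as_ tds] st.
    have := Hd s; rewrite /ball_/= in_itv/= st ltW//= ger0_norm ?subr_ge0//.
    rewrite ltrBlDr -ltrBlDl => /(_ tds isT).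
    rewrite ltr_norml => /andP[h1 _].
    have em : g t = - (m + m) by rewrite /m; field.
    by move: h1; rewrite /from_subspace/=; lra.
have ta0 : 0 < t - a by rewrite subr_gt0.
have tc0 : 0 < t - c by rewrite subr_gt0.
near=> beta.
have beta0 : 0 < beta by near: beta; exact: nbhs_right_gt.
have beta1 : beta < 1 by near: beta; exact: nbhs_right_lt.
have betas : beta < m * (t - c) / ((M0 + m) * (t - a)).
  near: beta; apply: nbhs_right_lt.
  by apply: divr_gt0; apply: mulr_gt0 => //; exact: addr_gt0.
pose k s := (t - s) `^ (beta - 1).
pose K := (M0 + m) * k c.
have k0 s : 0 <= k s by exact: powR_ge0.
(* The single bound that covers both [a, c], where k s <= k c and
   g s + m <= M0 + m, and ]c, t], where g s + m <= 0. *)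
have kle s : `[a, t]%classic s -> k s * g s <= - m * k s + K.
  move=> sat; have := sat; rewrite /= in_itv/= => /andP[as_ st].
  rewrite -lerBlDl mulNr opprK (mulrC m) -mulrDr.
  have [sc|cs] := leP s c; last first.
    apply: (@le_trans _ _ 0); last by rewrite mulr_ge0// ltW// addr_gt0.
    rewrite mulr_ge0_le0// -lerBrDr sub0r; apply: Hc.
    by rewrite cs.
  apply: (@le_trans _ _ (k s * (M0 + m))).
    by rewrite ler_wpM2l// lerD2r HM.
  rewrite mulrC ler_wpM2l//; first by rewrite ltW// addr_gt0.
  (* beta - 1 < 0, so the monotonicity of powers is applied to the inverses. *)
  rewrite /k -(opprB 1 beta) !powRN lef_pV2 ?posrE ?powR_gt0//; last first.
    by rewrite (lt_le_trans tc0)// lerD2l lerN2.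
  apply: ge0_ler_powR; rewrite ?nnegrE ?subr_ge0 ?lerD2l ?lerN2//.
  + exact: ltW.
  + exact: ltW.
have mJ : measurable `[a, t] by exact: measurable_itv.
have iK : lebesgue_measure.-integrable `[a, t] (EFin \o (fun=> K)).
  apply: continuous_compact_integrable; first exact: segment_compact.
  by move=> x; exact: cvg_cst.
have ik := integrable_powR_right beta0 at0.
have imk : lebesgue_measure.-integrable `[a, t] (EFin \o (fun s => - m * k s)).
  exact: (integrableZl (mu := @lebesgue_measure R) mJ (- m) ik).
have Ik : \int[lebesgue_measure]_(s in `[a, t]) k s = (t - a) `^ beta / beta.
  rewrite /Rintegral integral_itv_bndoo.
    by rewrite integral_powR_right.
  apply: measurable_funS (measurable_int _ ik) => //.
  exact: subset_itv_oo_cc.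
have le : \int[lebesgue_measure]_(s in `[a, t]) (k s * g s) <=
    - m * ((t - a) `^ beta / beta) + K * (t - a).
  have Iub : \int[lebesgue_measure]_(s in `[a, t]) (- m * k s + K) =
      - m * ((t - a) `^ beta / beta) + K * (t - a).
    rewrite RintegralD// RintegralZl// Ik Rintegral_cst//; congr (_ + _ * _).
    by rewrite /= lebesgue_measure_itv/= lte_fin at0.
  rewrite -Iub; apply: le_Rintegral => //.
  - exact: integrable_kernelM.
  - exact: (integrableD (mu := @lebesgue_measure R) mJ imk iK).
rewrite /RL_integral pmulr_rlt0; last first.
  by rewrite invr_gt0 Gamma_itv01_gt0// beta0 ltW.
apply: (le_lt_trans le).
rewrite mulNr addrC subr_lt0 mulrA ltr_pdivlMr//.
(* Multiplying by t - c turns k c into the power (t - c) `^ beta, which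
   compares with (t - a) `^ beta. *)
rewrite -(ltr_pM2r tc0).
have Ec : k c * (t - c) = (t - c) `^ beta by rewrite mulrC mulr_powRB1// ltW.
have ple : (t - c) `^ beta <= (t - a) `^ beta.
  by apply: ge0_ler_powR; rewrite ?nnegrE ?lerD2l ?lerN2// ltW.
have pa0 : 0 < (t - a) `^ beta by exact: powR_gt0.
rewrite (_ : K * _ * _ * _ = (M0 + m) * (t - a) * beta * (k c * (t - c))); last first.
  by rewrite /K; ring.
rewrite Ec; apply: (@le_lt_trans _ _ ((M0 + m) * (t - a) * beta * (t - a) `^ beta)).
  by rewrite ler_wpM2l// ltW// !mulr_gt0// addr_gt0.
rewrite [ltRHS]mulrAC ltr_pM2r// mulrC -ltr_pdivlMr//.
by apply: mulr_gt0 => //; exact: addr_gt0.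
Unshelve. all: by end_near. Qed.

Lemma RL_integral_ge0_imp_ge0 (R : realType) (a b : R) (g : R -> R) :
  {within `[a, b], continuous g} ->
  (forall t, t \in `]a, b[ -> \forall beta \near 0^'+, 0 <= RL_integral beta a g t) ->
  {in `]a, b[, forall t, 0 <= g t}.
Proof.
move=> cg H t tab; rewrite leNgt; apply/negP => gt0.
have /andP[at0 tb] : a < t < b by move: tab; rewrite in_itv.
have cgt : {within `[a, t], continuous g}.
  by apply: continuous_subspaceW cg; apply: subset_itvl; rewrite bnd_simp ltW.
have /(@filter_ex _ _ (at_right_proper_filter 0))[beta [RLlt0]] : \forall beta \near 0^'+,
    RL_integral beta a g t < 0 /\ 0 <= RL_integral beta a g t.
  near=> beta; split.
  - by near: beta; exact: RL_integral_near0_lt0.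
  - by near: beta; exact: H.
by rewrite leNgt RLlt0.
Unshelve. all: by end_near. Qed.

(** * Differentiability relative to a segment *)

(** The segment is a neighbourhood of its interior points, so there the limit
along the segment is the two-sided one. *)
Lemma derivable_in_is_derive (R : realType) (a b x : R) (f : R -> R) :
  x \in `]a, b[ -> derivable_in `[a, b] f x ->
  is_derive x 1 f (derive_in `[a, b] f x).
Proof.
move=> xab df.
have nx : nbhs x `[a, b]%classic.
  apply: (@filterS _ _ _ `]a, b[%classic); first exact: subset_itv_oo_cc.
  by apply: open_nbhs_nbhs; split => //; exact: interval_open.
have cv : h^-1 *: ((f \o shift x) (h *: (1 : R)) - f x) @[h --> 0^'] -->
    derive_in `[a, b] f x.
  apply/cvgrPdist_lt => e e0.
  move/cvgrPdist_lt : df => /(_ _ e0)[d /= d0 Hd].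
  move: nx => [r /= r0 Hr].
  near=> h.
  have h0 : h != 0 by near: h; exact: nbhs_dnbhs_neq.
  have hd : `|h| < d by near: h; exact: dnbhs0_lt.
  have hr : `|h| < r by near: h; exact: dnbhs0_lt.
  have := Hd (h + x).
  rewrite /ball_/= opprD addrCA subrr addr0 normrN => /(_ hd).
  rewrite -subr_eq0 addrK => /(_ h0).
  have : `[a, b]%classic (h + x).
    by apply: Hr; rewrite /ball_/= opprD addrCA subrr addr0 normrN.
  move=> /[swap] /[apply].
  by rewrite /GRing.scale/= mulr1 mulrC.
by apply: DeriveDef; [apply/cvg_ex; eexists; exact: cv|exact: cvg_lim cv].
Unshelve. all: by end_near. Qed.

(** Away from x, f y is the difference quotient times y - x, plus f x. *)
Lemma derivable_in_continuous (R : realType) (D : set R) (f : R -> R) :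
  (forall x, D x -> derivable_in D f x) -> {within D, continuous f}.
Proof.
move=> df; apply/subspace_continuousP => x Dx.
have cq : diff_quotient_in D f x --> derive_in D f x := df _ Dx.
have c1 : (f y - f x) / (y - x) * (y - x) + f x @[y --> within D x^'] --> f x.
  rewrite -[X in _ --> X](add0r (f x)) -(mulr0 (derive_in D f x)).
  apply: cvgD; last exact: cvg_cst.
  apply: cvgM; first exact: cq.
  rewrite -(subrr x); apply: cvgB; last exact: cvg_cst.
  by move=> P Px; apply: filterS Px => y Py _ _.
apply/cvgrPdist_lt => e e0.
move/cvgrPdist_lt : c1 => /(_ _ e0)[d /= d0 Hd].
exists d => //= y xy Dy.
have [->|yx] := eqVneq y x; first by rewrite subrr normr0.
have := Hd y xy yx Dy.
by rewrite divfK ?subr_eq0// subrK.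
Qed.

(** * Monotonicity from the sign of the Caputo derivatives *)

Theorem theorem2p2 (R : realType) (a b : R) (f : R -> R) (hab : a < b)
    (hf : C1_on a b f) :
  ((exists2 alpha0 : R, 0 < alpha0 < 1 &
      forall t alpha : R, t \in `[a, b] -> alpha0 < alpha < 1 ->
        0 <= Caputo alpha a b f t) ->
    {in `[a, b] &, {homo f : x y / x <= y}}) /\
  ((exists2 alpha0 : R, 0 < alpha0 < 1 &
      forall t alpha : R, t \in `[a, b] -> alpha0 < alpha < 1 ->
        Caputo alpha a b f t <= 0) ->
    {in `[a, b] &, {homo f : x y /~ x <= y}}).
Proof.
have [df cg] := hf.
have dfo x : x \in `]a, b[ -> is_derive x 1 f (derive_in `[a, b] f x).
  move=> xab; apply: derivable_in_is_derive => //.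
  exact/df/subset_itv_oo_cc.
have cf : {within `[a, b], continuous f} by exact: derivable_in_continuous.
have dfx x : x \in `]a, b[ -> derivable f x 1 by move=> /dfo [].
split=> -[alpha0 /andP[alpha00 alpha01] H].
- apply: ger0_derive1_le_cc => // x xab.
  rewrite derive1E (derive_val (is_derive := dfo x xab)).
  apply: (RL_integral_ge0_imp_ge0 cg) (x) xab => t tab.
  near=> beta.
  rewrite -(subKr 1 beta); apply: H; first exact: subset_itv_oo_cc.
  rewrite ltrBrDr addrC -ltrBrDr ltrBlDr ltrDl.
  by apply/andP; split; near: beta;
    [apply: nbhs_right_lt; rewrite subr_gt0|exact: nbhs_right_gt].
- apply: ler0_derive1_le_cc => // x xab.
  rewrite derive1E (derive_val (is_derive := dfo x xab)).
  rewrite -oppr_ge0.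
  apply: (@RL_integral_ge0_imp_ge0 _ a b (fun s => - derive_in `[a, b] f s)) (x) xab.
    by move=> y; exact/continuousN/cg.
  move=> t tab.
  have /andP[at0 tb] : a < t < b by move: tab; rewrite in_itv.
  near=> beta.
  have beta0 : 0 < beta by near: beta; exact: nbhs_right_gt.
  rewrite RL_integralN//; last first.
    by apply: continuous_subspaceW cg; apply: subset_itvl; rewrite bnd_simp ltW.
  rewrite oppr_ge0 -(subKr 1 beta); apply: H; first exact: subset_itv_oo_cc.
  rewrite ltrBrDr addrC -ltrBrDr ltrBlDr ltrDl beta0 andbT.
  by near: beta; apply: nbhs_right_lt; rewrite subr_gt0.
Unshelve. all: by end_near. Qed.
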